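(* Let $X$ and $\{X_n\}_{n=1}^{\infty}$ be compact non-Archimedean metric spaces. Then $X_n\longrightarrow_{\mathrm{GH}_S}X$ if and only if the following holds: for every $\varepsilon>0$ there exist a finite $\varepsilon$-net $S$ in $X$ and a finite $\varepsilon$-net $S_n$ in each $X_n$ such that $S_n\longrightarrow_{\mathrm{GH}_S}S$. Moreover, these $\varepsilon$-nets can be chosen so that, for all sufficiently large $n$, $S_n$ has the same cardinality as $S$.
   Context: A non-Archimedean metric space $(X,\widehat{d}_X)$ is a set with a metric satisfying the strong triangle inequality $\widehat{d}_X(x,z)\le\max\{\widehat{d}_X(x,y),\widehat{d}_X(y,z)\}$. The non-Archimedean Gromov-Hausdorff distance is $\widehat{d}_{GH}(X,Y)=\inf\{\widehat{d}_{H}(f(X),g(Y))\}$, the infimum being over all non-Archimedean metric spaces $(Z,\widehat{d}_Z)$ and all isometric embeddings $f:X\hookrightarrow Z$, $g:Y\hookrightarrow Z$, where $\widehat{d}_H$ is the Hausdorff distance between subsets of $Z$. For non-Archimedean metric spaces, $X_n\longrightarrow_{\mathrm{GH}_S}X$ means $\widehat{d}_{GH}(X_n,X)\to 0$ as $n\to\infty$. A subset $S$ of a metric space $(X,d)$ is an $\varepsilon$-net if $\operatorname{dist}(x,S)=\inf_{s\in S}d(x,s)<\varepsilon$ for all $x\in X$. Subsets are given the restricted metric. *)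

(* Defs.v *)
From HB Require Import structures.
From mathcomp Require Import all_boot all_order all_algebra.
From mathcomp Require Import all_classical all_reals all_analysis.

Set Implicit Arguments.
Unset Strict Implicit.
Unset Printing Implicit Defensive.

Import Order.TTheory GRing.Theory Num.Theory.
Import numFieldNormedType.Exports.

Local Open Scope classical_set_scope.
Local Open Scope ring_scope.

(* [set_type A] already carries the induced pseudometric; this adds the
   restriction of [mdist], so that any subset of a metric space is itself a
   [metricType]. *)
Section restricted_metric.
Context {R : realType} {X : metricType R} (A : set X).

Let dist (x y : A) : R := mdist (val x) (val y).

Let dist_ge0 x y : 0 <= dist x y.
Proof. exact: mdist_ge0. Qed.

Let dist_positivity x y : dist x y = 0 -> x = y.
Proof. by move=> /mdist_positivity/val_inj. Qed.

Let ballEdist x d : ball x d = [set y | dist x y < d].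
Proof. by rewrite -initial_ballE set_valE ballEmdist. Qed.

HB.instance Definition _ := @PseudoMetric_isMetric.Build R (A : Type)
  dist dist_ge0 dist_positivity ballEdist.

End restricted_metric.

Definition non_archimedean {R : realType} (X : metricType R) : Prop :=
  forall x y z : X, mdist x z <= Num.max (mdist x y) (mdist y z).

Definition isometric_embedding {R : realType} {X Z : metricType R}
    (f : X -> Z) : Prop :=
  forall x y : X, mdist (f x) (f y) = mdist x y.

(* Extended-real valued, so that the distance to the empty set is +oo. *)
Definition dist_to {R : realType} {X : metricType R} (x : X) (S : set X) :
    \bar R :=
  ereal_inf [set (mdist x s)%:E | s in S].

Definition is_net {R : realType} {X : metricType R} (e : R) (S : set X) :
    Prop :=
  forall x : X, (dist_to x S < e%:E)%E.

(* The infimum of the r > 0 such that each set lies in the open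
   r-neighbourhood of the other; it is 0 between two empty sets and +oo between
   an empty set and a nonempty one. *)
Definition hausdorff_dist {R : realType} {Z : metricType R} (A B : set Z) :
    \bar R :=
  ereal_inf (EFin @` [set r : R | [/\ 0 < r,
    forall a, A a -> (dist_to a B < r%:E)%E &
    forall b, B b -> (dist_to b A < r%:E)%E]]).

Definition gh_dist {R : realType} (X Y : metricType R) : \bar R :=
  ereal_inf [set d | exists (Z : metricType R) (f : X -> Z) (g : Y -> Z),
    [/\ non_archimedean Z, isometric_embedding f, isometric_embedding g &
        d = hausdorff_dist (range f) (range g)]].

Definition gh_cvg {R : realType} (X_ : nat -> metricType R)
    (X : metricType R) : Prop :=
  gh_dist (X_ n) X @[n --> \oo] --> 0%E.

(* Main.v *)
(* If X and Y sit in an ultrametric space Z at Hausdorff distance < e, and S is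
   a finite e-net of X with distinct points at distance >= e (one point in each
   open e-ball of X), then moving every point of S by less than e inside Z into
   Y changes no distance, by the isosceles triangle property: the image T of S
   in Y is isometric to S, and it is again an e-net.  Hence S_n can be taken
   isometric to S as soon as d_GH(X_n, X) < e.

   Conversely, let S and T be e-nets of X and Y that sit in Z at Hausdorff
   distance < e, and let p : X -> S and q : Y -> T send each point to a net
   point at distance < e.  Then d(x, y) = max(e, d_Z(p x, q y)) extends the
   metrics of X and Y to an ultrametric on their disjoint union, in which X and
   Y are at Hausdorff distance at most e. *)
Require Import Defs.
From HB Require Import structures.
From mathcomp Require Import all_boot all_order all_algebra finmap.
From mathcomp Require Import all_classical all_reals all_analysis.

Set Implicit Arguments.
Unset Strict Implicit.
Unset Printing Implicit Defensive.

Import Order.TTheory GRing.Theory Num.Theory.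
Import numFieldNormedType.Exports.

Local Open Scope classical_set_scope.
Local Open Scope card_scope.
Local Open Scope ring_scope.

(** * Ultrametric inequalities *)

Lemma non_archimedean_sub (R : realType) (X : metricType R) (A : set X) :
  non_archimedean X -> non_archimedean (set_type A).
Proof. by move=> naX x y z; exact: naX. Qed.

Lemma mdist_le_max (R : realType) (X : metricType R) (y x z : X) (e : R) :
  non_archimedean X -> mdist x y <= e -> mdist y z <= e -> mdist x z <= e.
Proof. by move=> naX xy yz; rewrite (le_trans (naX _ y _))// ge_max xy. Qed.

(** In an ultrametric space [mdist _ _ <= e] is symmetric and transitive, so related points are
    interchangeable in it. *)
Lemma mdist_le_perturb (R : realType) (X : metricType R) (x x' y y' : X)
    (e : R) :
  non_archimedean X -> mdist x y <= e -> mdist x' y' <= e ->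
  (mdist y y' <= e) = (mdist x x' <= e).
Proof.
move=> naX xy xy'; apply/idP/idP => h.
  apply: (mdist_le_max (y := y)) => //.
  by apply: (mdist_le_max (y := y')) => //; rewrite metric_sym.
apply: (mdist_le_max (y := x)) => //; first by rewrite metric_sym.
exact: (mdist_le_max (y := x')).
Qed.

(** The isosceles property: going through [a] and [b] cannot lengthen the distance, and a shorter
    one would give [mdist a b < mdist a b]. *)
Lemma non_archimedean_perturb (R : realType) (Z : metricType R)
    (a a' b b' : Z) :
  non_archimedean Z -> mdist a a' < mdist a b -> mdist b b' < mdist a b ->
  mdist a' b' = mdist a b.
Proof.
move=> naZ aa' bb'; apply/eqP; rewrite eq_le; apply/andP; split.
  rewrite (le_trans (naZ _ a _))// ge_max metric_sym ltW//=.
  by rewrite (le_trans (naZ _ b _))// ge_max lexx/= ltW.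
rewrite leNgt; apply/negP => h.
suff : mdist a b < mdist a b by rewrite ltxx.
rewrite {1}(le_lt_trans (naZ _ a' _))// gt_max aa'/=.
by rewrite (le_lt_trans (naZ _ b' _))// gt_max h/= metric_sym.
Qed.

(** * Strict upper bounds on distances defined as infima *)

Lemma dist_to_ltP (R : realType) (X : metricType R) (x : X) (S : set X)
    (e : R) :
  (dist_to x S < e%:E)%E <-> exists2 s, S s & mdist x s < e.
Proof.
rewrite /dist_to; split.
  by move=> /ereal_inf_lt[_ [s Ss <-]]; rewrite lte_fin; exists s.
move=> [s Ss xs]; apply: le_lt_trans (_ : ((mdist x s)%:E < _)%E).
  by apply: ereal_inf_lbound; exists s.
by rewrite lte_fin.
Qed.

Lemma hausdorff_dist_lt (R : realType) (Z : metricType R) (A B : set Z)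
    (e : R) :
  (hausdorff_dist A B < e%:E)%E ->
  (forall a, A a -> exists2 b, B b & mdist a b < e) /\
  (forall b, B b -> exists2 a, A a & mdist b a < e).
Proof.
move=> /ereal_inf_lt[_ [r [r0 AB BA] <-]]; rewrite lte_fin => re.
split=> [a /AB|b /BA] /dist_to_ltP[c Cc d]; exists c => //; exact: lt_trans re.
Qed.

Lemma close_hausdorff_dist_lt (R : realType) (Z : metricType R) (A B : set Z)
    (e r : R) :
  0 <= e -> e < r ->
  (forall a, A a -> exists2 b, B b & mdist a b <= e) ->
  (forall b, B b -> exists2 a, A a & mdist b a <= e) ->
  (hausdorff_dist A B < r%:E)%E.
Proof.
(* Admissible radii are positive with strict neighbourhoods, so [e] itself may fail; the midpoint of
   [e] and [r] is admissible. *)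
move=> e0 er AB BA; have [em mr] := midf_lt er.
apply: (@le_lt_trans _ _ ((e + r) / 2)%:E); last by rewrite lte_fin.
apply: ereal_inf_lbound; exists ((e + r) / 2) => //.
split=> [|a /AB[b Bb ab]|b /BA[a Aa ba]]; first exact: le_lt_trans em.
  by apply/dist_to_ltP; exists b => //; exact: le_lt_trans em.
by apply/dist_to_ltP; exists a => //; exact: le_lt_trans em.
Qed.

Lemma gh_dist_ltP (R : realType) (X Y : metricType R) (e : R) :
  (gh_dist X Y < e%:E)%E <->
  exists (Z : metricType R) (f : X -> Z) (g : Y -> Z),
    [/\ non_archimedean Z, isometric_embedding f, isometric_embedding g &
        (hausdorff_dist (range f) (range g) < e%:E)%E].
Proof.
split.
  by move=> /ereal_inf_lt[_ [Z [f [g [? ? ? ->]]]] ?]; exists Z, f, g.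
move=> [Z [f [g [naZ fi gi]]]]; apply: le_lt_trans; apply: ereal_inf_lbound.
by exists Z, f, g.
Qed.

Lemma gh_dist_ge0 (R : realType) (X Y : metricType R) : (0 <= gh_dist X Y)%E.
Proof.
apply/ereal_infP => _ [Z [f [g [_ _ _ ->]]]].
by apply/ereal_infP => _ [r [r0 _ _] <-]; rewrite lee_fin ltW.
Qed.

Lemma gh_cvgP (R : realType) (X_ : nat -> metricType R) (X : metricType R) :
  gh_cvg X_ X <->
  forall e : R, 0 < e -> \forall n \near \oo, (gh_dist (X_ n) X < e%:E)%E.
Proof.
split=> [cv e e0|H].
  apply: (cv (fun u => (u < e%:E)%E)).
  by apply: (@open_ereal_lt' R 0%E); rewrite lte_fin.
move=> A [e /= e0 eA]; apply: filterS (H _ e0) => n /=.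
(* Nonnegativity excludes [-oo] and the strict bound excludes [+oo]; what remains is a real number
   within [e] of 0. *)
have := gh_dist_ge0 (X_ n) X.
case: (gh_dist (X_ n) X) => [r| |]//; rewrite lee_fin lte_fin => r0 re.
by apply: eA; rewrite /= sub0r normrN ger0_norm.
Qed.

(** * Finite separated nets in compact spaces *)

Lemma compact_finite_cover (R : realType) (X : metricType R) (e : R) :
  compact [set: X] -> 0 < e ->
  exists2 D : set X, finite_set D & forall x, exists2 d, D d & mdist d x < e.
Proof.
(* [cover_compact] is used on a pointed type, so the empty space is treated apart. *)
move=> cX e0; have [[x0 _]|] := pselect (exists x : X, True); last first.
  by move=> nX; exists set0 => // x; case: nX; exists x.
pose pX : ptopologicalType := HB.pack X (isPointed.Build X x0).
have : @cover_compact pX [set: X] by rewrite -compact_cover.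
move=> /(_ X setT (fun x => (ball x e)°)) [x _|x _|D _ Dcov].
- exact: open_interior.
- by exists x => //; exact: nbhsx_ballx.
exists [set` (D : {fset X})]; first exact: finite_fset.
move=> x; have [d Dd /interior_subset] := Dcov x I.
by rewrite ballEmdist; exists d.
Qed.

Lemma compact_separated_net (R : realType) (X : metricType R) (e : R) :
  non_archimedean X -> compact [set: X] -> 0 < e ->
  exists S : set X, [/\ finite_set S, is_net e S &
    forall s t, S s -> S t -> s != t -> e <= mdist s t].
Proof.
move=> naX cX e0; have [D finD Dcov] := compact_finite_cover cX e0.
(* Every point of an open ball is a centre of it, so [rep] picks one point in
   each open ball of radius [e]. *)
pose rep (x : X) := choose (fun y => mdist x y < e) x.
have repP x : mdist x (rep x) < e.
  by apply: (@chooseP _ (fun y => mdist x y < e)); rewrite mdistxx.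
have repE x y : mdist x y < e -> rep x = rep y.
  (* The two balls coincide, so the predicates agree; the fallback point of [choose] is irrelevant,
     as [x] and [y] both lie in the ball. *)
  move=> xy; rewrite /rep (@eq_choose _ _ (fun z => mdist y z < e)).
    by apply: choose_id; rewrite ?mdistxx// metric_sym.
  move=> z; apply/idP/idP => h.
    by rewrite (le_lt_trans (naX _ x _))// gt_max metric_sym xy.
  by rewrite (le_lt_trans (naX _ y _))// gt_max xy.
exists (rep @` D); split; first exact: finite_image.
  move=> x; apply/dist_to_ltP; have [d Dd dx] := Dcov x.
  by exists (rep d); [exists d|rewrite (repE _ _ dx)].
(* If the representatives are less than [e] apart, the chain [x], [rep x], [rep y], [y] puts [x] and
   [y] in one ball. *)
move=> _ _ [x _ <-] [y _ <-]; apply: contraNle => xy; apply/eqP/repE.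
rewrite (le_lt_trans (naX _ (rep x) _))// gt_max repP.
rewrite (le_lt_trans (naX _ (rep y) _))// gt_max xy.
by rewrite metric_sym repP.
Qed.

Lemma gh_dist_isometry (R : realType) (X Y : metricType R) (g : Y -> X)
    (e : R) :
  non_archimedean X -> isometric_embedding g -> range g = setT -> 0 < e ->
  (gh_dist X Y < e%:E)%E.
Proof.
move=> naX gi gsurj e0; apply/gh_dist_ltP; exists X, id, g; split => //.
rewrite gsurj image_id; apply: (close_hausdorff_dist_lt (lexx 0)) => // x _;
  by exists x => //; rewrite mdistxx.
Qed.

(** * Gluing two ultrametric spaces along a cross distance *)

Definition glued_dist (R : realType) (X Y : metricType R) (c : X -> Y -> R)
    (u v : X + Y) : R :=
  match u, v with
  | inl x, inl x' => mdist x x'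
  | inl x, inr y => c x y
  | inr y, inl x => c x y
  | inr y, inr y' => mdist y y'
  end.

(** Up to symmetry, the four inequalities on [c] are the mixed cases of the strong triangle
    inequality; [0 < c x y] separates the two summands. *)
Lemma non_archimedean_glue (R : realType) (X Y : metricType R)
    (c : X -> Y -> R) :
  non_archimedean X -> non_archimedean Y ->
  (forall x y, 0 < c x y) ->
  (forall x x' y, c x y <= Num.max (mdist x x') (c x' y)) ->
  (forall x y y', c x y <= Num.max (c x y') (mdist y' y)) ->
  (forall x x' y, mdist x x' <= Num.max (c x y) (c x' y)) ->
  (forall x y y', mdist y y' <= Num.max (c x y) (c x y')) ->
  exists (Z : metricType R) (f : X -> Z) (g : Y -> Z),
    [/\ non_archimedean Z, isometric_embedding f, isometric_embedding g &
        forall x y, mdist (f x) (g y) = c x y].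
Proof.
move=> naX naY c0 cXr cYr cX cY.
pose d := glued_dist c.
have dC u v : d u v = d v u by case: u v => [x|y] [x'|y'] //=;
    exact: metric_sym.
have dna v u w : d u w <= Num.max (d u v) (d v w).
  case: u v w => [x|y] [x'|y'] [x''|y''] //=;
    rewrite /d/= ?[mdist y y']metric_sym;
    by rewrite // maxC // metric_sym.
have d0 u : d u u = 0 by case: u => [x|y] /=; exact: mdistxx.
have d_ge0 u v : 0 <= d u v.
  by case: u v => [x|y] [x'|y'] /=; rewrite ?mdist_ge0// ltW.
have d_eq0 u v : d u v = 0 -> u = v.
  case: u v => [x|y] [x'|y'] /=; try by move=> /mdist_positivity->.
    by move=> /eqP; rewrite gt_eqF.
  by move=> /eqP; rewrite gt_eqF.
have dtri v u w : d u w <= d u v + d v w.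
  by rewrite (le_trans (dna v _ _))// ge_max lerDl lerDr !d_ge0.
pose Z : metricType R := HB.pack (X + Y)%type
  (isMetric.Build R (X + Y)%type d0 d_eq0 dC dtri).
by exists Z, inl, inr; split.
Qed.

Lemma gh_dist_nets (R : realType) (X Y : metricType R) (S : set X) (T : set Y)
    (e r : R) :
  non_archimedean X -> non_archimedean Y -> 0 < e -> e < r ->
  is_net e S -> is_net e T -> (gh_dist (set_type S) (set_type T) < e%:E)%E ->
  (gh_dist X Y < r%:E)%E.
Proof.
move=> naX naY e0 er netS netT /gh_dist_ltP[Z [f [g [naZ fi gi]]]].
move=> /hausdorff_dist_lt[fg gf].
have /choice[p pP] : forall x, exists s : set_type S, mdist x (val s) < e.
  move=> x; have /dist_to_ltP[s Ss xs] := netS x.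
  by exists (SigSub (mem_set Ss)).
have /choice[q qP] : forall y, exists t : set_type T, mdist y (val t) < e.
  move=> y; have /dist_to_ltP[t Tt yt] := netT y.
  by exists (SigSub (mem_set Tt)).
pose c x y := Num.max e (mdist (f (p x)) (g (q y))).
(* Bounds [M >= e] do not distinguish a point from its net point. Every maximum below involves [c],
   hence is at least [e], so each mixed inequality reduces to the strong triangle inequality in
   [Z]. *)
have fpE x x' M : e <= M ->
    (mdist (f (p x)) (f (p x')) <= M) = (mdist x x' <= M).
  by move=> eM; rewrite fi; apply: (@mdist_le_perturb _ X) => //;
    rewrite (le_trans _ eM)// ltW.
have gqE y y' M : e <= M ->
    (mdist (g (q y)) (g (q y')) <= M) = (mdist y y' <= M).
  by move=> eM; rewrite gi; apply: (@mdist_le_perturb _ Y) => //;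
    rewrite (le_trans _ eM)// ltW.
have [|||||Z' [f' [g' [naZ' fi' gi' cE]]]] :=
  @non_archimedean_glue _ _ _ c naX naY.
- by move=> x y; rewrite lt_max e0.
- move=> x x' y; set M := Num.max _ _.
  have eM : e <= M by rewrite !le_max lexx orbT.
  rewrite ge_max eM/=; apply: (mdist_le_max (y := f (p x'))) => //.
    by rewrite fpE// le_max lexx.
  by rewrite !le_max lexx !orbT.
- move=> x y y'; set M := Num.max _ _.
  have eM : e <= M by rewrite !le_max lexx.
  rewrite ge_max eM/=; apply: (mdist_le_max (y := g (q y'))) => //.
    by rewrite !le_max lexx !orbT.
  by rewrite gqE// le_max lexx orbT.
- move=> x x' y; set M := Num.max _ _.
  have eM : e <= M by rewrite !le_max lexx.
  rewrite -fpE//; apply: (mdist_le_max (y := g (q y))) => //.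
    by rewrite !le_max lexx !orbT.
  by rewrite metric_sym !le_max lexx !orbT.
- move=> x y y'; set M := Num.max _ _.
  have eM : e <= M by rewrite !le_max lexx.
  rewrite -gqE//; apply: (mdist_le_max (y := f (p x))) => //.
    by rewrite metric_sym !le_max lexx !orbT.
  by rewrite !le_max lexx !orbT.
have c_le x y : mdist (f (p x)) (g (q y)) < e -> c x y <= e.
  by move=> /ltW xy; rewrite ge_max lexx.
apply/gh_dist_ltP; exists Z', f', g'; split => //.
apply: (close_hausdorff_dist_lt (ltW e0) er).
- move=> _ [x _ <-]; have [|_ [t _ <-] xt] := fg (f (p x)).
    by exists (p x).
  (* [q] need not fix [val t], but moves it by less than [e], so the cross distance is still at the
     floor [e]. *)
  exists (g' (val t)); first by exists (val t).
  rewrite cE c_le// (le_lt_trans (naZ _ (g t) _))// gt_max xt gi.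
  exact: qP.
- move=> _ [y _ <-]; have [|_ [s _ <-] ys] := gf (g (q y)).
    by exists (q y).
  exists (f' (val s)); first by exists (val s).
  rewrite metric_sym cE c_le// metric_sym (le_lt_trans (naZ _ (f s) _))//.
  by rewrite gt_max ys fi; exact: pP.
Qed.

(** * Transfer of a separated net to a nearby space *)

Lemma separated_net_transfer (R : realType) (X Y : metricType R) (S : set X)
    (e : R) :
  non_archimedean Y -> finite_set S -> is_net e S ->
  (forall s t, S s -> S t -> s != t -> e <= mdist s t) ->
  (gh_dist Y X < e%:E)%E ->
  exists T : set Y, [/\ finite_set T, is_net e T, T #= S &
    forall r : R, 0 < r -> (gh_dist (set_type T) (set_type S) < r%:E)%E].
Proof.
move=> naY finS netS sepS /gh_dist_ltP[Z [f [g [naZ fi gi]]]].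
move=> /hausdorff_dist_lt[fg gf].
have /choice[h hP] : forall x, exists y, mdist (g x) (f y) < e.
  move=> x; have [|_ [y _ <-] xy] := gf (g x); first by exists x.
  by exists y.
have hi s t : S s -> S t -> mdist (h s) (h t) = mdist s t.
  move=> Ss St; have [->|st] := eqVneq s t; first by rewrite !mdistxx.
  (* Both ends move by less than [e], which separation bounds by [mdist s t]. *)
  rewrite -fi -gi; apply: non_archimedean_perturb => //.
    by rewrite gi (lt_le_trans (hP s))// sepS.
  by rewrite gi (lt_le_trans (hP t))// sepS.
exists (h @` S); split; first exact: finite_image.
- move=> y; apply/dist_to_ltP.
  have [|_ [x _ <-] yx] := fg (f y); first by exists y.
  have /dist_to_ltP[s Ss xs] := netS x; exists (h s); first by exists s.
  (* The chain [f y], [g x], [g s], [f (h s)] in [Z] has all its steps below [e]. *)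
  rewrite -fi (le_lt_trans (naZ _ (g x) _))// gt_max yx/=.
  by rewrite (le_lt_trans (naZ _ (g s) _))// gt_max gi xs hP.
- apply: inj_card_eq => s t /set_mem Ss /set_mem St hst.
  by apply: mdist_positivity; rewrite -hi// hst mdistxx.
move=> r r0.
have hS (s : set_type S) : h (val s) \in h @` S.
  by apply/mem_set; exists (val s) => //; exact: set_valP.
pose k (s : set_type S) : set_type (h @` S) := SigSub (hS s).
apply: (@gh_dist_isometry _ _ _ k) => //.
- exact: non_archimedean_sub.
- by move=> s t; apply: hi; exact: set_valP.
apply/seteqP; split=> // -[y yS] _ /=.
have [s Ss hsy] := set_mem yS.
by exists (SigSub (mem_set Ss)) => //; exact/val_inj.
Qed.

Theorem theorem3p8 (R : realType)
    (X : metricType R) (X_ : nat -> metricType R)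
    (naX : non_archimedean X) (cptX : compact [set: X])
    (naX_ : forall n, non_archimedean (X_ n))
    (cptX_ : forall n, compact [set: X_ n]) :
  (gh_cvg X_ X <->
   forall e : R, 0 < e ->
     exists (S : set X) (S_ : forall n, set (X_ n)),
       [/\ finite_set S /\ is_net e S,
           forall n, finite_set (S_ n) /\ is_net e (S_ n) &
           gh_cvg (fun n => set_type (S_ n) : metricType R) (set_type S)])
  /\
  (gh_cvg X_ X ->
   forall e : R, 0 < e ->
     exists (S : set X) (S_ : forall n, set (X_ n)),
       [/\ finite_set S /\ is_net e S,
           forall n, finite_set (S_ n) /\ is_net e (S_ n),
           gh_cvg (fun n => set_type (S_ n) : metricType R) (set_type S) &
           \forall n \near \oo, S_ n #= S]).
Proof.
suff nets : gh_cvg X_ X -> forall e : R, 0 < e ->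
    exists (S : set X) (S_ : forall n, set (X_ n)),
      [/\ finite_set S /\ is_net e S,
          forall n, finite_set (S_ n) /\ is_net e (S_ n),
          gh_cvg (fun n => set_type (S_ n) : metricType R) (set_type S) &
          \forall n \near \oo, S_ n #= S].
  split=> //; split=> [/nets H e /H[S [S_ [? ? ? _]]]|H]; first by exists S, S_.
  (* Nets at scale [e / 2] leave the strict gap that [gh_dist_nets] asks for. *)
  apply/gh_cvgP => e e0; have e20 : 0 < e / 2 by rewrite divr_gt0.
  have [S [S_ [[_ netS] netS_ /gh_cvgP/(_ _ e20)]]] := H _ e20.
  apply: filterS => n; apply: gh_dist_nets => //; last by have [] := netS_ n.
  by rewrite ltr_pdivrMr// ltr_pMr// ltr1n.
move=> /gh_cvgP cvX e e0.
have [S [finS netS sepS]] := compact_separated_net naX cptX e0.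
(* Spaces still far from [X] receive an arbitrary finite net; stating the comparison with [S] as an
   implication lets one choice serve all [n]. *)
have S_ex n : exists T : set (X_ n), [/\ finite_set T, is_net e T &
    (gh_dist (X_ n) X < e%:E)%E -> T #= S /\
    forall r : R, 0 < r -> (gh_dist (set_type T) (set_type S) < r%:E)%E].
  have [h|h] := pselect (gh_dist (X_ n) X < e%:E)%E.
    have [T [? ? ? ?]] := separated_net_transfer (naX_ n) finS netS sepS h.
    by exists T.
  have [T [? ? _]] := compact_separated_net (naX_ n) (cptX_ n) e0.
  by exists T.
pose S_ n := projT1 (cid (S_ex n)).
have S_P n := projT2 (cid (S_ex n)).
exists S, S_; split => //.
- by move=> n; have [] := S_P n.
(* The threshold on [n] comes from [e] alone: past it, the nets are closer than every [r]. *)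
- apply/gh_cvgP => r r0; apply: filterS (cvX _ e0) => n.
  by have [_ _ H] := S_P n; move=> /H[_]; apply.
- by apply: filterS (cvX _ e0) => n; have [_ _ H] := S_P n; move=> /H[].
Qed.
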